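(* Let $\epsilon_E>0$ and $\alpha=2e^{-2N_s\epsilon_E^2}$. Suppose that for all $x\in\mathcal{D}_i$, $$|\hat\Phi^E_{p_i^{\top}\overline{G}\overline{\mathbf{w}}}(x)-\hat\Phi_{p_i^{\top}\overline{G}\overline{\mathbf{w}}}(x)|\le\epsilon_D ,$$ and that $\hat\Phi^l_{p_i^{\top}\overline{G}\overline{\mathbf{w}}}$ satisfies, for all $x\in\mathcal{D}_i$, $$0\le\hat\Phi_{p_i^{\top}\overline{G}\overline{\mathbf{w}}}(x)-\hat\Phi^l_{p_i^{\top}\overline{G}\overline{\mathbf{w}}}(x)\le\epsilon .$$ Then, with probability at least $1-\alpha$, $$\hat\Phi^l_{p_i^{\top}\overline{G}\overline{\mathbf{w}}}(x)-\epsilon-\epsilon_E-\epsilon_D\le\Phi_{p_i^{\top}\overline{G}\overline{\mathbf{w}}}(x)\qquad\text{for all }x\in\mathcal{D}_i .$$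
   Context: Let $\overline{\mathbf{w}}\in\mathbb{R}^{pN}$ be a random vector, $\overline{G}\in\mathbb{R}^{n(N+1)\times pN}$ a matrix and $p_i\in\mathbb{R}^{n(N+1)}$ a vector, so that $p_i^\top\overline{G}\overline{\mathbf{w}}$ is a real random variable. Let $\Phi_{p_i^\top\overline{G}\overline{\mathbf{w}}}$ be its cumulative distribution function. Let $\overline{\mathbf{w}}_1,\dots,\overline{\mathbf{w}}_{N_s}$ be $N_s$ independent samples of $\overline{\mathbf{w}}$. The empirical cumulative distribution function is $\hat\Phi^E_{p_i^\top\overline{G}\overline{\mathbf{w}}}(x)=\frac1{N_s}\#\{j: p_i^\top\overline{G}\overline{\mathbf{w}}_j\le x\}$. The smoothed approximation $\hat\Phi_{p_i^\top\overline{G}\overline{\mathbf{w}}}$ is obtained from the empirical characteristic function $$\hat\varphi(s)=\frac1{N_s}\sum_{j=1}^{N_s}\exp(is\,p_i^\top\overline{G}\overline{\mathbf{w}}_j)\exp\left(-\tfrac12(p_i^\top\overline{G})\overline{\Sigma}(p_i^\top\overline{G})^\top s^2\right),\qquad s\in\mathbb{R},$$ where $\overline{\Sigma}\in\mathbb{R}^{pN\times pN}$ is a symmetric positive semidefinite smoothing matrix, by the inversion formula $$\hat\Phi_{p_i^\top\overline{G}\overline{\mathbf{w}}}(x)=\frac12-\frac1\pi\int_0^\infty\mathrm{Im}\left(\frac{e^{-isx}\hat\varphi(s)}{s}\right)ds .$$ The piecewise affine function is $\hat\Phi^l_{p_i^\top\overline{G}\overline{\mathbf{w}}}(x)=\min_{1\le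 r\le z^i}\{a_{i,r}x+c_{i,r}\}$ with finitely many real slopes $a_{i,r}$ and intercepts $c_{i,r}$, which may depend on the samples. $\mathcal{D}_i=[x_i^{lb},\infty)$ for some $x_i^{lb}\in\mathbb{R}$; $\epsilon>0$ and $\epsilon_D\ge0$ are constants. Probability is with respect to the draw of the samples. The hypotheses on $\epsilon_D$ and $\epsilon$ are taken to hold for the drawn samples. *)

(* Defs.v *)
From HB Require Import structures.
From mathcomp Require Import all_boot all_order all_algebra.
From mathcomp Require Import all_classical all_reals all_analysis.
From mathcomp Require Import measurable_realfun complex.

Set Implicit Arguments.
Unset Strict Implicit.
Unset Printing Implicit Defensive.

Import Order.TTheory GRing.Theory Num.Theory.
Import numFieldNormedType.Exports.

Local Open Scope classical_set_scope.
Local Open Scope ring_scope.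

(* Column vectors with the Borel sigma-algebra of the product topology. *)
Definition borel_cV (R : realType) (m : nat) :=
  g_sigma_algebraType (@open 'cV[R]_m).

Definition linear_form (R : realType) (m : nat) (c : 'rV[R]_m)
  (x : borel_cV R m) : R := (c *m (x : 'cV[R]_m)) 0 0.

Lemma measurable_linear_form (R : realType) (m : nat) (c : 'rV[R]_m) :
  measurable_fun [set: borel_cV R m] (linear_form c).
Proof.
apply: (measurability _ (RGenOpens.measurableE R)) => _ [_ [a [b ->] <-]].
rewrite setTI; apply: sub_sigma_algebra.
have linear_form_cont : continuous (linear_form c : 'cV[R]_m -> R).
  rewrite (_ : linear_form c = fun x : 'cV[R]_m => \sum_(k < m) c 0 k * x k 0).
    apply: continuous_big => [|k _ x]; first exact: add_continuous.
    apply: (@continuousM _ _ (fun=> c 0 k) (fun y : 'cV[R]_m => y k 0)).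
      exact: cst_continuous.
    exact: coord_continuous.
  by apply/funext => x; rewrite /linear_form mxE.
by apply: open_comp => [x _|]; [exact: linear_form_cont | exact: interval_open].
Qed.

HB.instance Definition _ (R : realType) (m : nat) (c : 'rV[R]_m) :=
  isMeasurableFun.Build _ _ (borel_cV R m) R (linear_form c)
    (measurable_linear_form c).

Definition linear_RV d (T : measurableType d) (R : realType) (m : nat)
    (P : probability T R) (c : 'rV[R]_m) (w : {RV P >-> borel_cV R m}) :
    {RV P >-> R} :=
  linear_form c \o w.

Definition mutually_independent d d' (T : measurableType d)
    (T' : measurableType d') (R : realType) (P : probability T R)
    (I : finType) (X : I -> {RV P >-> T'}) : Prop :=
  forall (J : {set I}) (B : I -> set T'),
    (forall i, i \in J -> measurable (B i)) ->
    P (\bigcap_(i in [set i | i \in J]) (X i @^-1` B i)) =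
      (\prod_(i in J) P (X i @^-1` B i))%E.

(* [X] need not live on the same probability space as [w]. *)
Definition independent_samples d0 (T0 : measurableType d0) d
    (T : measurableType d) d' (T' : measurableType d') (R : realType)
    (P0 : probability T0 R) (P : probability T R)
    (w : {RV P0 >-> T'}) (n : nat) (X : 'I_n -> {RV P >-> T'}) : Prop :=
  mutually_independent X /\
  forall j (B : set T'), measurable B ->
    distribution P (X j) B = distribution P0 w B.

Definition positive_semidefinite (R : realType) (m : nat) (S : 'M[R]_m) : Prop :=
  S^T = S /\ forall u : 'rV[R]_m, 0 <= (u *m S *m u^T) 0 0.

Section distribution_functions.
Variable R : realType.

Definition real_cdf d (T : measurableType d) (P : probability T R)
  (X : {RV P >-> R}) (x : R) : R := fine (cdf X x).

Definition empirical_cdf (n : nat) (y : 'I_n -> R) (x : R) : R :=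
  n%:R^-1 * #|[pred j | y j <= x]|%:R.

Local Open Scope complex_scope.

Definition cexp (z : R[i]) : R[i] :=
  (expR (complex.Re z))%:C *
  (cos (complex.Im z) +i* sin (complex.Im z)).

(* [y] are the projected samples, [v] the projected smoothing variance. *)
Definition smoothed_ecf (n : nat) (y : 'I_n -> R) (v : R) (s : R) : R[i] :=
  (n%:R^-1)%:C *
  \sum_(j < n) cexp (0 +i* (s * y j)) * cexp (- (2^-1 * v * s ^+ 2))%:C.

(* The integral over ]0, +oo[ is an improper one: when [v = 0] the integrand
   is in general not Lebesgue integrable at infinity. *)
Definition cdf_of_cf (phi : R -> R[i]) (x : R) : R :=
  2^-1 - pi^-1 *
    lim ((\int[@lebesgue_measure R]_(s in `]0, t])
            complex.Im (cexp (0 -i* (s * x)) * phi s / s%:C))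
         @[t --> +oo]).

Definition smoothed_cdf (n : nat) (y : 'I_n -> R) (v : R) : R -> R :=
  cdf_of_cf (smoothed_ecf y v).

(* Pieces are numbered 1, ..., z; for z >= 1 the default of the iterated
   minimum is one of the pieces, so this is the plain minimum. *)
Definition min_affine (z : nat) (a c : nat -> R) (x : R) : R :=
  \big[Num.min/a 1%N * x + c 1%N]_(1 <= r < z.+1) (a r * x + c r).

End distribution_functions.

(* The event [E] is not required to be measurable: it holds with probability
   at least [q] if it contains a measurable event of that probability. *)
Definition holds_with_prob_ge d (T : measurableType d) (R : realType)
    (P : probability T R) (q : R) (E : set T) : Prop :=
  exists A : set T, [/\ measurable A, A `<=` E & (q%:E <= P A)%E].

Lemma holds_with_prob_geE d (T : measurableType d) (R : realType)
    (P : probability T R) (q : R) (E : set T) : measurable E ->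
  holds_with_prob_ge P q E <-> (q%:E <= P E)%E.
Proof.
move=> mE; split=> [[A [mA AE qA]]|qE]; last by exists E; split.
by rewrite (le_trans qA)// le_measure ?inE.
Qed.

(* Main.v *)
Require Import Defs.
From HB Require Import structures.
From mathcomp Require Import all_boot all_order all_algebra.
From mathcomp Require Import all_classical all_reals all_analysis.
From mathcomp Require Import measurable_realfun ring lra.

Set Implicit Arguments.
Unset Strict Implicit.
Unset Printing Implicit Defensive.

Import Order.TTheory GRing.Theory Num.Theory.
Import numFieldNormedType.Exports.

Local Open Scope classical_set_scope.
Local Open Scope ring_scope.

(** Write F for the true distribution function, F_n for the empirical one,
    E for [epsE].  On the two hypotheses, the approximation minus [epsD] is at
    most F_n, so the claim follows from F_n <= F + E + [eps] holding everywhere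
    with probability at least 1 - alpha.  This is a one-sided
    Dvoretzky-Kiefer-Wolfowitz inequality with Massart's exponent 2nE^2
    ([dkw_one_sided]); it holds with constant 1, hence with alpha, and the room
    left by [eps] > 0 allows R to be replaced by finitely many levels.

    The probabilistic idea is a likelihood ratio.  Let t be the probability of
    an initial segment and N the number of samples that it contains.  For fixed
    k > 0, the variables (1 + k/t)^N / (1 + k)^n, read from the largest segment
    to the smallest one, form a martingale of mean 1: they are the density of
    the law of n samples drawn from the tilted measure
    (mu + k delta_bottom) / (1 + k), relative to that of n samples drawn from
    mu, once the positions inside the segment are forgotten.  If N exceeds
    n(t + E), the density is at least ((1 + k/t)^(t + E) / (1 + k))^n, so once
    k satisfies
      (t + E) ln (1 + k/t) >= ln (1 + k) + 2E^2   for every t > 0,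
    the maximal inequality bounds the probability that some segment is
    overfull by exp(-2nE^2).  On finitely many levels this is a rearrangement of
    finite sums: split by the last overfull level and compare the two laws on
    the fibres of the map that forgets the positions inside that segment
    ([last_overshoot_le], [sum_overshoots_le]).

    The existence of k is [crossing_exponent].  Let 1 + 2E = x/(1 - e^(-x)) and
    k = (e^x - 1)/2.  In the variable s = ln (1 + k/t) the left-hand side is
    k s/(e^s - 1) + E s, which is convex and stationary at s = x, that is at
    t = 1/2.  There the inequality involves x only; the difference of its two
    sides tends to 0 as x does, and its derivative in x is a square times a
    positive factor.

    To pass from R to levels, a point u is sent to the integer part of K F(u).
    Since P(F(Y) < s) <= s ([cdf_prob_lt]), replacing a ray by the points
    of at most its level costs at most 1/K in probability, and it can only
    increase the empirical count. *)

(** * The exponent *)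

Section exponent.
Context {R : realType}.
Implicit Types (x y s t eps : R) (f df : R -> R).

Lemma is_derive_MVT f df x y : x <= y ->
  (forall z, x <= z <= y -> is_derive z 1 f (df z)) ->
  exists2 z, x <= z <= y & f y - f x = df z * (y - x).
Proof.
move=> xy dfE.
have [z|z zxy|z] := MVT_segment xy (f := f) (df := df).
- by rewrite in_itv/= => /andP[/ltW xz /ltW zy]; apply: dfE; rewrite xz.
- apply: derivable_within_continuous => {}z; rewrite in_itv/= => /dfE dfz.
  exact: ex_derive.
- by rewrite in_itv/= => zxy ->; exists z.
Qed.

Lemma is_derive_ge0_le f df x y : x <= y ->
  (forall z, x <= z <= y -> is_derive z 1 f (df z)) ->
  (forall z, x <= z <= y -> 0 <= df z) -> f x <= f y.
Proof.
move=> xy dfE df0; have [z zxy fxy] := is_derive_MVT xy dfE.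
by rewrite -subr_ge0 fxy mulr_ge0 ?df0// subr_ge0.
Qed.

Lemma expR_subr1_gt0 x : 0 < x -> 0 < expR x - 1.
Proof. by move=> x0; rewrite subr_gt0 -expR0 ltr_expR. Qed.

(** This is [tanh (x / 2) <= x / 2]; it gives the sign of the second derivative
    of [bernoulli_gf]. *)
Lemma tanh_half_le x : 0 <= x -> 2 * (expR x - 1) <= x * (expR x + 1).
Proof.
move=> x0; rewrite -subr_ge0.
pose f := fun z : R => z * (expR z + 1) - 2 * (expR z - 1).
have -> : 0 = f 0 by rewrite /f expR0; ring.
apply: (@is_derive_ge0_le f (fun z => 1 + (z - 1) * expR z)) => // z _.
  by apply: is_derive_eq; rewrite /GRing.scale/=; ring.
have : (1 - z) * expR z <= expR (- z) * expR z.
  by rewrite ler_wpM2r ?expR_ge0// expR_ge1Dx.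
rewrite -expRD addNr expR0; lra.
Qed.

(** The generating function of the Bernoulli numbers.  With
    [s = ln (1 + k / t)] one has [t * s = k * bernoulli_gf s], which turns the
    dependence on [t] of the exponent into that of a convex function of [s]. *)
Definition bernoulli_gf x := x / (expR x - 1).
Definition dbernoulli_gf x :=
  (expR x - 1 - x * expR x) / (expR x - 1) ^+ 2.

Lemma is_derive_bernoulli_gf x : 0 < x ->
  is_derive x 1 bernoulli_gf (dbernoulli_gf x).
Proof.
move=> x0; have E0 : expR x - 1 != 0 by rewrite gt_eqF ?expR_subr1_gt0.
have dV := @is_deriveV R (fun z => expR z - 1) x 1 _ E0 _.
by apply: is_derive_eq; rewrite /GRing.scale/= /dbernoulli_gf; field.
Qed.

Lemma dbernoulli_gf_le x y : 0 < x -> x <= y ->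
  dbernoulli_gf x <= dbernoulli_gf y.
Proof.
move=> x0 xy.
apply: (@is_derive_ge0_le dbernoulli_gf (fun z =>
  expR z * (z * (expR z + 1) - 2 * (expR z - 1)) / (expR z - 1) ^+ 3)) => //
  z /andP[xz _]; have z0 := lt_le_trans x0 xz.
  have E0 : expR z - 1 != 0 by rewrite gt_eqF ?expR_subr1_gt0.
  have E20 : (expR z - 1) ^+ 2 != 0 by rewrite expf_neq0.
  have dV := @is_deriveV R (fun z => (expR z - 1) ^+ 2) z 1 _ E20 _.
  by apply: is_derive_eq; rewrite /GRing.scale/=; field.
by rewrite divr_ge0 ?mulr_ge0 ?exprn_ge0 ?expR_ge0 ?subr_ge0 ?tanh_half_le//
  ?ltW// -subr_gt0 expR_subr1_gt0.
Qed.

Lemma bernoulli_gf_tangent x s : 0 < x -> 0 < s ->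
  bernoulli_gf x + dbernoulli_gf x * (s - x) <= bernoulli_gf s.
Proof.
move=> x0 s0; have [xs|/ltW sx] := leP x s.
  have [z /andP[xz _] dE] := is_derive_MVT xs
    (fun z zxs => is_derive_bernoulli_gf (lt_le_trans x0 (andP zxs).1)).
  rewrite -lerBrDl dE ler_wpM2r ?subr_ge0//; exact: dbernoulli_gf_le.
have [z /andP[sz zx] dE] := is_derive_MVT sx
    (fun z zxs => is_derive_bernoulli_gf (lt_le_trans s0 (andP zxs).1)).
rewrite -lerBrDl -[s - x]opprB mulrN -[bernoulli_gf s - _]opprB lerN2 dE.
rewrite ler_wpM2r ?subr_ge0//; apply: dbernoulli_gf_le => //.
exact: lt_le_trans sz.
Qed.

(** Tuning [x] by [slope x = 1 + 2 * eps] makes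
    [t |-> (t + eps) * ln (1 + k / t)], for [k = (expR x - 1) / 2], minimal at
    [t = 1 / 2]. *)
Definition slope x := x * expR x / (expR x - 1).

(** The minimal value [(1 / 2 + eps) * x] minus [ln (1 + k) + 2 * eps ^+ 2],
    written in terms of [x]. *)
Definition gap x :=
  slope x * x / 2 - ln ((1 + expR x) / 2) - (slope x - 1) ^+ 2 / 2.

Lemma is_derive_gap x : 0 < x -> is_derive x 1 gap
  (2 * expR x * (expR x + 1) * (x / 2 - (expR x - 1) / (expR x + 1)) ^+ 2
   / (expR x - 1) ^+ 3).
Proof.
move=> x0; have E0 : expR x - 1 != 0 by rewrite gt_eqF ?expR_subr1_gt0.
have E1 : 0 < 1 + expR x by rewrite addr_gt0// expR_gt0.
have E2 : 0 < (1 + expR x) / 2 by rewrite divr_gt0.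
have dV := @is_deriveV R (fun z => expR z - 1) x 1 _ E0 _.
have dl := is_derive1_ln E2.
have dc := @is_derive1_comp R (@ln R) (fun z => (1 + expR z) / 2) x _ _ dl _.
have da : is_derive x 1 slope (expR x * (expR x - 1 - x) / (expR x - 1) ^+ 2).
  by apply: is_derive_eq; rewrite /GRing.scale/=; field.
rewrite /gap; apply: is_derive_eq; rewrite /GRing.scale/= /slope.
by field; rewrite E0 addrC gt_eqF.
Qed.

Lemma slope_bounds x : 0 < x -> x <= slope x <= 1 + x.
Proof.
move=> x0; have E0 := expR_subr1_gt0 x0.
rewrite /slope ler_pdivlMr// ler_pdivrMr//; apply/andP; split.
  by rewrite ler_pM2l// gerBl.
have := expR_ge1Dx x; lra.
Qed.

(** The derivative is nonnegative, so everything is decided near 0. *)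
Lemma gap_ge0 x : 0 < x -> 0 <= gap x.
Proof.
move=> x0; apply/ler_addgt0Pr => e e0.
(* [gap] increases and tends to 0 at 0, where [slope] is not defined; a crude
   lower bound of order [y] near 0 replaces the limit. *)
pose y := Num.min x (Num.min 1 (e / 2)).
have y0 : 0 < y by rewrite !lt_min x0 ltr01/=; lra.
have yx : y <= x by rewrite ge_min lexx.
have y1 : y <= 1 by rewrite !ge_min lexx orbT.
have ye : y <= e / 2 by rewrite !ge_min lexx !orbT.
have My : - e <= gap y.
  have /andP[ay1 ay2] := slope_bounds y0.
  have lny : ln ((1 + expR y) / 2) <= y.
    have E0 := expR_subr1_gt0 y0.
    have E2 : 0 < (1 + expR y) / 2 by lra.
    by rewrite -[leRHS]expRK ler_ln ?posrE ?expR_gt0//; lra.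
  have ay0 : 0 <= slope y * y / 2.
    by rewrite divr_ge0// mulr_ge0// ?(le_trans _ ay1)// ltW.
  have : 1 <= slope y.
    rewrite /slope ler_pdivlMr ?expR_subr1_gt0// mul1r.
    have : (1 - y) * expR y <= expR (- y) * expR y.
      by rewrite ler_wpM2r ?expR_ge0// expR_ge1Dx.
    rewrite -expRD addNr expR0; lra.
  move=> ay; have : (slope y - 1) ^+ 2 <= y; last by rewrite /gap; lra.
  by rewrite expr2 -[leRHS]mulr1 ler_pM//; lra.
rewrite -lerBlDr sub0r; apply: (le_trans My).
apply: (is_derive_ge0_le yx
  (fun z zyx => is_derive_gap (lt_le_trans y0 (andP zyx).1))).
move=> z /andP[yz _]; have z0 := lt_le_trans y0 yz.
have E0 := expR_subr1_gt0 z0.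
by rewrite divr_ge0 ?exprn_ge0 ?(ltW E0)// mulr_ge0 ?sqr_ge0.
Qed.

Lemma slope_surj eps : 0 < eps -> exists2 x, 0 < x & slope x = 1 + 2 * eps.
Proof.
move=> e0; pose f x : R := (1 + 2 * eps) * (expR x - 1) - x * expR x.
have [|||x xe fx0] := @IVT R f (2 * eps) (1 + 2 * eps) 0.
- lra.
- apply: derivable_within_continuous => {}x _.
  by apply: ex_derive.
(* [f] changes sign: at [2 * eps] its value is [expR x - 1 - x], and at
   [1 + 2 * eps] it is [- x]. *)
- have h1 : 0 <= f (2 * eps) by rewrite /f; have := expR_ge1Dx (2 * eps); lra.
  have h2 : f (1 + 2 * eps) <= 0 by rewrite /f; lra.
  by rewrite ge_min h2 orbT le_max h1.
move: xe; rewrite in_itv/= => /andP[x1 _].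
have x0 : 0 < x by lra.
exists x => //; have E0 := expR_subr1_gt0 x0.
apply: (mulIf (lt0r_neq0 E0)); rewrite divfK ?lt0r_neq0//.
by move: fx0; rewrite /f; lra.
Qed.

(** Massart's exponent [2 * eps ^+ 2] with a single [k] for all [t]: convexity
    reduces the claim to [t = 1 / 2], where it is [gap_ge0]. *)
Lemma crossing_exponent eps : 0 < eps ->
  exists2 k, 0 < k & forall t, 0 < t ->
  ln (1 + k) + 2 * eps ^+ 2 <= (t + eps) * ln (1 + k / t).
Proof.
move=> eps0; have [x x0 ax] := slope_surj eps0.
have E0 := expR_subr1_gt0 x0.
have k0 : 0 < (expR x - 1) / 2 by rewrite divr_gt0.
exists ((expR x - 1) / 2) => // t t0; set k := (expR x - 1) / 2.
set s := ln (1 + k / t).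
have kt0 : 0 < k / t by rewrite divr_gt0.
have Es : expR s - 1 = k / t by rewrite lnK ?posrE ?ltr_wpDl//; ring.
have s0 : 0 < s by rewrite ln_gt0// ltrDl.
have ts : t * s = k * bernoulli_gf s.
  by rewrite /bernoulli_gf Es; field; rewrite !gt_eqF.
have kB : k * bernoulli_gf x = x / 2.
  by rewrite /k /bernoulli_gf; field; rewrite gt_eqF.
have kdB : k * dbernoulli_gf x = - eps.
  have -> : eps = (slope x - 1) / 2 by rewrite ax; field.
  by rewrite /k /dbernoulli_gf /slope; field; rewrite gt_eqF.
have := bernoulli_gf_tangent x0 s0.
rewrite -(ler_pM2l k0) -/k -ts [k * (_ + _)]mulrDr mulrA kB kdB => tang.
have := gap_ge0 x0; rewrite /gap ax.
have -> : (1 + expR x) / 2 = 1 + k by rewrite /k; field.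
lra.
Qed.
End exponent.

(** * Finitely many levels *)

Section levels.
Context {R : realType} {n m : nat}.
Implicit Types (q : 'I_m.+1 -> R) (f g : {ffun 'I_n -> 'I_m.+1}).
Implicit Types (i k v : 'I_m.+1) (c eps : R).

Definition mass q i : R := \sum_(k < m.+1 | (k <= i)%N) q k.
Definition count_le f i : nat := #|[pred j | (f j <= i)%N]|.
Definition overshoots q eps f i : bool :=
  n%:R * (mass q i + eps) < (count_le f i)%:R.

(** [lump i] forgets the positions at and below [i]; the numbers of samples at
    or below [i' >= i] survive ([count_le_lump]). *)
Definition lump i k : 'I_m.+1 := if (k <= i)%N then i else k.
Definition lump_all i f : {ffun 'I_n -> 'I_m.+1} := [ffun j => lump i (f j)].

Lemma lump_le i i' k : (i <= i')%N -> (lump i k <= i')%N = (k <= i')%N.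
Proof.
by move=> ii'; rewrite /lump; case: ifPn => // /leq_trans/(_ ii') ->.
Qed.

Lemma count_le_lump i i' f : (i <= i')%N ->
  count_le (lump_all i f) i' = count_le f i'.
Proof.
by move=> ii'; apply: eq_card => j; rewrite !inE ffunE lump_le.
Qed.

Lemma sum_lump q i v : \sum_(k | lump i k == v) q k =
  if (v < i)%N then 0 else if v == i then mass q i else q v.
Proof.
case: ltngtP => [vi|iv|/val_inj ->].
- rewrite big_pred0// => k; apply/eqP => kv; move: vi.
  rewrite -kv /lump; case: (leqP k i) => [_|/ltnW ki]; first by rewrite ltnn.
  by rewrite ltnNge ki.
- rewrite -val_eqE/= gtn_eqF// (big_pred1 v)// => k; rewrite /lump.
  case: (leqP k i) => // ki; rewrite /= -!val_eqE/= (ltn_eqF iv).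
  by rewrite (ltn_eqF (leq_ltn_trans ki iv)).
- rewrite eqxx; apply: eq_bigl => k; rewrite /lump.
  by case: (leqP k i) => [|ik]; rewrite ?eqxx// -val_eqE/= gtn_eqF.
Qed.

Lemma sum_lump_all q i g :
  \sum_(f | lump_all i f == g) \prod_j q (f j) =
  \prod_j \sum_(k | lump i k == g j) q k.
Proof.
rewrite (bigA_distr_big_dep (fun j k => lump i k == g j)).
apply: eq_bigl => f; apply/eqP/familyP => [<- j|fg].
  by rewrite unfold_in ffunE.
by apply/ffunP => j; have /eqP := fg j; rewrite ffunE.
Qed.

(** Mixing in a point mass at the bottom level raises the mass of every initial
    segment, and scales all the levels above it by the same factor. *)
Definition tilt c q k : R := (q k + c *+ (k == ord0)) / (1 + c).

Lemma tilt_ge0 c q k : 0 < c -> (forall i, 0 <= q i) -> 0 <= tilt c q k.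
Proof.
move=> /ltW c0 q0; apply: divr_ge0; last exact: addr_ge0.
by rewrite addr_ge0 ?mulrn_wge0.
Qed.

Lemma mass_tilt c q i : mass (tilt c q) i = (mass q i + c) / (1 + c).
Proof.
rewrite /mass /tilt -mulr_suml big_split/=; congr ((_ + _) / _).
by rewrite (bigD1 ord0)//= big1 ?addr0// => k /andP[_ /negPf ->].
Qed.

Lemma sum_tilt c q : 0 < c -> \sum_k q k = 1 -> \sum_k tilt c q k = 1.
Proof.
move=> c0 q1; have -> : \sum_k tilt c q k = mass (tilt c q) ord_max.
  by apply: eq_bigl => k; rewrite /= -ltnS ltn_ord.
have qm : mass q ord_max = 1.
  by rewrite -q1; apply: eq_bigl => k; rewrite /= -ltnS ltn_ord.
by rewrite mass_tilt qm divff// gt_eqF// addr_gt0.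
Qed.

(** The one-sample likelihood ratio of the tilted law, once the positions at and
    below [i] are forgotten. *)
Lemma sum_lump_tilt c q i v : 0 < c -> 0 < mass q i ->
  \sum_(k | lump i k == v) tilt c q k =
  (\sum_(k | lump i k == v) q k) *
    ((if (v <= i)%N then 1 + c / mass q i else 1) / (1 + c)).
Proof.
move=> c0 t0; rewrite !sum_lump; case: ltngtP => [vi|iv|/val_inj ->].
- by rewrite mul0r.
- have -> : (v == i) = false by rewrite -val_eqE/= gtn_eqF.
  have v0 : (v == ord0) = false.
    by rewrite -val_eqE/= (gtn_eqF (leq_ltn_trans (leq0n _) iv)).
  by rewrite /tilt v0 mulr0n addr0 mul1r.
- rewrite eqxx mass_tilt; field.
  by rewrite !gt_eqF// addr_gt0.
Qed.

Definition last_overshoot q eps i f : bool :=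
  overshoots q eps f i &&
  [forall i' : 'I_m.+1, (i < i')%N ==> ~~ overshoots q eps f i'].

(** Scanning from the top, [i] is reached before any sample below it is seen, so
    forgetting the positions there does not affect the event. *)
Lemma last_overshoot_lump q eps i f :
  last_overshoot q eps i (lump_all i f) = last_overshoot q eps i f.
Proof.
rewrite /last_overshoot /overshoots count_le_lump//; congr (_ && _).
apply: eq_forallb => i'; case: ltnP => //= ii'.
by rewrite count_le_lump// ltnW.
Qed.

Lemma sum_overshoots q eps (F : {ffun 'I_n -> 'I_m.+1} -> R) :
  \sum_(f | [exists i, overshoots q eps f i]) F f =
  \sum_i \sum_(f | last_overshoot q eps i f) F f.
Proof.
pose tau f := odflt ord0 [pick i | last_overshoot q eps i f].
rewrite (partition_big tau xpredT)//=; apply: eq_bigr => i _.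
apply: eq_bigl => f; apply/andP/idP => [[/existsP[i0 oi0] /eqP <-]|oi].
  rewrite /tau; case: pickP => [//|/= nolast].
  have [i1 oi1 i1max] := arg_maxnP (fun i => i : nat) oi0.
  have := nolast i1; rewrite /last_overshoot oi1/= => /forallP[] i'.
  by apply/implyP; apply: contraTN => /i1max; rewrite -leqNgt.
have /andP[oi1 /forallP il] := oi.
split; first by apply/existsP; exists i.
rewrite /tau; case: pickP => [i' /=|/(_ i)/=]; last by rewrite oi.
move=> /andP[oi' /forallP i'l].
rewrite -val_eqE/=; case: ltngtP => // ii'.
- by have := i'l i; rewrite ii' oi1.
- by have := il i'; rewrite ii' oi'.
Qed.

(** On each fibre of [lump_all i], if the segment has positive mass, the tilted
    law is the original one times
    [(1 + c / mass q i) ^+ count_le g i / (1 + c) ^+ n], which is at least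
    [expR (2 * n%:R * eps ^+ 2)] because [i] overshoots. *)
Lemma last_overshoot_le q c eps i : 0 < c -> 0 < eps ->
  (forall k, 0 <= q k) ->
  (forall t, 0 < t ->
     ln (1 + c) + 2 * eps ^+ 2 <= (t + eps) * ln (1 + c / t)) ->
  \sum_(f | last_overshoot q eps i f) \prod_j q (f j) <=
  expR (- (2 * n%:R * eps ^+ 2)) *
    \sum_(f | last_overshoot q eps i f) \prod_j tilt c q (f j).
Proof.
move=> c0 eps0 q0 cE.
rewrite (partition_big (lump_all i) (last_overshoot q eps i))//=; last first.
  by move=> f; rewrite last_overshoot_lump.
rewrite [X in _ * X](partition_big (lump_all i) (last_overshoot q eps i))//=;
  last first.
  by move=> f; rewrite last_overshoot_lump.
rewrite mulr_sumr; apply: ler_sum => g lg.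
have lumpE f : last_overshoot q eps i f && (lump_all i f == g) =
    (lump_all i f == g).
  by apply: andb_idl => /eqP fg; rewrite -last_overshoot_lump fg.
under eq_bigl do rewrite lumpE.
under [X in _ * X]eq_bigl do rewrite lumpE.
rewrite !sum_lump_all.
have oi : overshoots q eps g i by case/andP: lg.
have t0 : 0 <= mass q i by exact: sumr_ge0.
have sq0 v : 0 <= \sum_(k | lump i k == v) q k by exact: sumr_ge0.
have N0 : (0 < count_le g i)%N.
  rewrite -(ltr_nat R); apply: le_lt_trans oi.
  by rewrite mulr_ge0// addr_ge0// ltW.
(* If the segment has mass 0, the ratio is not available, but then a sample in
   it, which exists since [i] overshoots, makes the left-hand side vanish. *)
have [tE|tN] := eqVneq (mass q i) 0.
  have /card_gt0P[j] := N0; rewrite inE => gji.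
  rewrite (bigD1 j)//= [X in X * _]sum_lump.
  have -> :
      (if (g j < i)%N then 0 else if g j == i then mass q i else q (g j)) = 0.
    by case: ltngtP gji => // /val_inj ->; rewrite eqxx tE.
  rewrite mul0r mulr_ge0 ?expR_ge0// prodr_ge0// => j' _.
  by apply: sumr_ge0 => k _; exact: tilt_ge0.
have {}t0 : 0 < mass q i by rewrite lt_def tN.
under [X in _ * X]eq_bigr do rewrite sum_lump_tilt//.
rewrite big_split/= mulrCA ler_peMr ?prodr_ge0//.
have c1 : 0 < 1 + c by rewrite addr_gt0.
have ct1 : 0 < 1 + c / mass q i by rewrite addr_gt0// divr_gt0.
have -> : \prod_(j < n)
      ((if (g j <= i)%N then 1 + c / mass q i else 1) / (1 + c)) =
    (1 + c / mass q i) ^+ count_le g i * (1 + c) ^- n.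
  by rewrite big_split/= -big_mkcond/= !prodr_const card_ord exprVn.
have h : n%:R * (ln (1 + c) + 2 * eps ^+ 2) <=
    (count_le g i)%:R * ln (1 + c / mass q i).
  apply: le_trans (_ : n%:R * ((mass q i + eps) * ln (1 + c / mass q i)) <= _).
    by rewrite ler_wpM2l ?cE.
  rewrite mulrA ler_wpM2r ?(ltW oi)// ln_ge0// lerDl.
  by rewrite divr_ge0 ?(ltW t0) ?(ltW c0).
rewrite -{1}(@lnK R (1 + c / mass q i)) ?posrE// -(@lnK R (1 + c)) ?posrE//.
rewrite -!expRM_natl -expRN -!expRD -[leLHS]expR0 ler_expR; lra.
Qed.

(** Summing over the last overshoot compares the probability of an overshoot
    with its tilted counterpart, which is at most 1. *)
Lemma sum_overshoots_le q eps : 0 < eps -> (forall k, 0 <= q k) ->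
  \sum_k q k = 1 ->
  \sum_(f | [exists i, overshoots q eps f i]) \prod_j q (f j) <=
  expR (- (2 * n%:R * eps ^+ 2)).
Proof.
move=> eps0 q0 q1; have [c c0 cE] := crossing_exponent eps0.
apply: (@le_trans _ _ (expR (- (2 * n%:R * eps ^+ 2)) *
    \sum_(f | [exists i, overshoots q eps f i]) \prod_j tilt c q (f j))).
  rewrite !sum_overshoots mulr_sumr; apply: ler_sum => i _.
  exact: last_overshoot_le.
rewrite -[leRHS]mulr1 ler_pM2l ?expR_gt0//.
have total1 : \sum_(f : {ffun 'I_n -> 'I_m.+1}) \prod_j tilt c q (f j) = 1.
  by rewrite -(bigA_distr_bigA (fun=> tilt c q)) big1// => j _; exact: sum_tilt.
rewrite -[leRHS]total1.
rewrite [leRHS](bigID (fun f => [exists i, overshoots q eps f i]))/=.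
rewrite lerDl; apply: sumr_ge0 => f _; apply: prodr_ge0 => j _.
exact: tilt_ge0.
Qed.

End levels.

(** * From independent samples to levels *)

Lemma distribution_levels d (T : measurableType d) d' (T' : measurableType d')
    (R : realType) (P : probability T R) (w : {RV P >-> T'})
    (m : nat) (lev : T' -> 'I_m.+1) (p : {pred 'I_m.+1}) :
  (forall k, measurable (lev @^-1` [set k])) ->
  \sum_(k < m.+1 | p k) fine (distribution P w (lev @^-1` [set k])) =
  fine (distribution P w [set x | p (lev x)]).
Proof.
move=> mlev; apply: EFin_inj.
have lev_cover : [set x | p (lev x)] =
    \big[setU/set0]_(k < m.+1 | p k) (lev @^-1` [set k]).
  rewrite -bigcup_seq_cond; apply/seteqP; split => x /=.
    by move=> px; exists (lev x) => //=; rewrite mem_index_enum.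
  by move=> [k /=/andP[_ pk] ->].
have mcover : measurable [set x | p (lev x)].
  by rewrite lev_cover; exact: bigsetU_measurable.
rewrite -sumEFin fineK ?fin_num_measure//.
under eq_bigr do rewrite fineK ?fin_num_measure//.
by rewrite lev_cover measure_bigsetU_ord// => k k' _ _ [x /= [<- <-]].
Qed.

Lemma measure_bigsetU_le d (T : measurableType d) (R : realType)
    (mu : {measure set T -> \bar R}) (I : Type) (r : seq I) (p : pred I)
    (F : I -> set T) : (forall i, measurable (F i)) ->
  (mu (\big[setU/set0]_(i <- r | p i) F i) <= \sum_(i <- r | p i) mu (F i))%E.
Proof.
move=> mF.
suff [] : measurable (\big[setU/set0]_(i <- r | p i) F i) /\
    (mu (\big[setU/set0]_(i <- r | p i) F i) <=
      \sum_(i <- r | p i) mu (F i))%E by [].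
elim/big_rec2 : _ => [|i s A pi [mA As]]; first by rewrite measure0.
split; first exact: measurableU.
by rewrite (le_trans (measureU2 _ _ _))// leeD2l.
Qed.

(** Independence makes the joint law of the levels of the samples the product
    weight of [sum_overshoots_le]. *)
Lemma samples_count_le d0 (T0 : measurableType d0) d
    (T : measurableType d) d' (T' : measurableType d') (R : realType)
    (P0 : probability T0 R) (P : probability T R)
    (w : {RV P0 >-> T'}) (n : nat) (X : 'I_n -> {RV P >-> T'})
    (m : nat) (lev : T' -> 'I_m.+1) (eps : R) :
  independent_samples w X -> (forall k, measurable (lev @^-1` [set k])) ->
  0 < eps ->
  holds_with_prob_ge P (1 - expR (- (2 * n%:R * eps ^+ 2)))
    [set omega | forall i : 'I_m.+1,
      #|[pred j | (lev (X j omega) <= i)%N]|%:R <=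
      n%:R * (fine (distribution P0 w [set x | (lev x <= i)%N]) + eps)].
Proof.
move=> [indep idd] mlev eps0.
pose q k := fine (distribution P0 w (lev @^-1` [set k])).
have q0 k : 0 <= q k by rewrite fine_ge0.
have q1 : \sum_k q k = 1.
  rewrite (distribution_levels w xpredT)//.
  by rewrite (_ : [set x | _] = setT) ?probability_setT//; apply/seteqP.
pose E (f : {ffun 'I_n -> 'I_m.+1}) :=
  \bigcap_(j in [set j | j \in [set: 'I_n]%SET])
    (X j @^-1` (lev @^-1` [set f j])).
have mX j B : measurable B -> measurable (X j @^-1` B).
  by move=> mB; rewrite -[X in measurable X]setTI; exact: measurable_funPT.
have mE f : measurable (E f).
  by apply: fin_bigcap_measurable => // j _; exact: mX.
have PE f : P (E f) = (\prod_j q (f j))%:E.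
  rewrite /E (indep _ (fun j => lev @^-1` [set f j]))//.
  rewrite -prodEFin; apply: eq_big => [j|j _]; first by rewrite finset.in_setT.
  by rewrite /q fineK ?fin_num_measure// -(idd j).
pose bad := \big[setU/set0]_(f | [exists i, overshoots q eps f i]) E f.
have mbad : measurable bad by exact: bigsetU_measurable.
have Pbad : (P bad <= (expR (- (2 * n%:R * eps ^+ 2)))%:E)%E.
  apply: le_trans
    (_ : (\sum_(f | [exists i, overshoots q eps f i]) P (E f) <= _)%E).
    exact: measure_bigsetU_le.
  under eq_bigr do rewrite PE.
  by rewrite sumEFin lee_fin sum_overshoots_le.
exists (~` bad); split; first exact: measurableC.
- move=> omega nbad i; rewrite leNgt; apply/negP => over; apply: nbad.
  pose f := [ffun j => lev (X j omega)].
  rewrite /bad -bigcup_seq_cond; exists f => /=; last first.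
    by move=> j _ /=; rewrite ffunE.
  rewrite mem_index_enum/=; apply/existsP; exists i.
  rewrite /overshoots /mass /q (distribution_levels w (fun k => (k <= i)%N))//.
  rewrite (_ : count_le f i = #|[pred j | (lev (X j omega) <= i)%N]|)//.
  by apply: eq_card => j; rewrite !inE ffunE.
- by rewrite probability_setC// EFinB leeB.
Qed.

(** * From levels to the distribution function *)

Lemma nondecreasing_real_cdf d (T : measurableType d) (R : realType)
    (P : probability T R) (Y : {RV P >-> R}) : nondecreasing_fun (real_cdf Y).
Proof.
move=> x y xy; rewrite /real_cdf fine_le ?fin_num_measure//.
exact: cdf_nondecreasing.
Qed.

(** The set is a left-unbounded interval.  If it has a largest point, its
    probability is a value of the distribution function; otherwise it is an
    increasing union of closed rays and continuity of the measure applies. *)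
Lemma cdf_prob_lt d (T : measurableType d) (R : realType) (P : probability T R)
    (Y : {RV P >-> R}) (s : R) : 0 <= s ->
  (distribution P Y [set u | (real_cdf Y u < s)%R] <= s%:E)%E.
Proof.
move=> s0; set A := [set u | _].
have cdfE u : A u -> (distribution P Y `]-oo, u] <= s%:E)%E.
  by move=> /ltW; rewrite -lee_fin /real_cdf fineK// fin_num_measure.
have down u v : A v -> u <= v -> A u.
  by move=> Av /nondecreasing_real_cdf/le_lt_trans; exact.
have exhaust (u : R^nat) : nondecreasing_seq u -> (forall n, A (u n)) ->
    (forall a, A a -> exists n, a <= u n) -> (distribution P Y A <= s%:E)%E.
  move=> u_nd uA Au.
  have -> : A = \bigcup_n `]-oo, u n]%classic.
    apply/seteqP; split => [a /Au[n an]|a [n _]].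
      by exists n => //=; rewrite in_itv.
    by rewrite /= in_itv/= => an; exact: down an.
  have mray k : measurable (`]-oo, u k]%classic) by exact: measurable_itv.
  have := @nondecreasing_cvg_mu _ _ _ (distribution P Y)
    (fun k => `]-oo, u k]%classic)
    mray (bigcup_measurable (fun k _ => mray k)).
  move=> cvgA; apply: (cvge_to_le (cvgA _)); last by near=> k; exact: cdfE.
  by move=> i j ij; apply/subsetPset/subset_itvl; rewrite bnd_simp; exact: u_nd.
have [[a0 Aa0]|A0] := pselect (A !=set0); last first.
  rewrite (_ : A = set0) ?measure0//; apply/seteqP; split => // a Aa.
  by apply: A0; exists a.
have [[r [Ar rmax]]|nomax] := pselect (exists r, A r /\ ubound A r).
  rewrite (_ : A = `]-oo, r]%classic); first exact: cdfE.
  apply/seteqP; split => a /=; rewrite in_itv/=; first exact: rmax.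
  exact: down.
have [ubA|nubA] := pselect (has_ubound A).
  have supA : has_sup A by split => //; exists a0.
  apply: (exhaust (fun n => sup A - n.+1%:R^-1)).
  - by move=> i j ij; rewrite lerD2l lerN2 lef_pV2 ?posrE// ler_nat.
  - move=> k; have k0 : 0 < k.+1%:R^-1 :> R by rewrite invr_gt0.
    have [a Aa /ltW ka] := sup_adherent k0 supA; exact: down ka.
  - move=> a Aa; have [b Ab ab] : exists2 b, A b & a < b.
      apply: contrapT => nob; apply: nomax; exists a; split => // b Ab.
      by rewrite leNgt; apply/negP => ab; apply: nob; exists b.
    have b_sup : b <= sup A by exact: ub_le_sup.
    have ba0 : 0 < b - a by rewrite subr_gt0.
    exists (Num.truncn (b - a)^-1).
    have : (Num.truncn (b - a)^-1).+1%:R^-1 <= b - a; last first.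
      by move: (_.+1%:R^-1) => v vba; lra.
    by rewrite -[leRHS]invrK lef_pV2 ?posrE ?invr_gt0// ltW// truncnS_gt.
apply: (exhaust (fun n => n%:R)).
- by move=> i j ij; rewrite ler_nat.
- move=> n; apply: contrapT => nAn; apply: nubA; exists n%:R => a Aa.
  by rewrite leNgt; apply/negP => /ltW/(down _ _ Aa).
- by move=> a _; exists (Num.truncn a).+1; rewrite ltW// truncnS_gt.
Unshelve. all: end_near. Qed.

Lemma real_cdf_ge0 d (T : measurableType d) (R : realType)
    (P : probability T R) (Y : {RV P >-> R}) x : 0 <= real_cdf Y x.
Proof. by rewrite fine_ge0// cdf_ge0. Qed.

Lemma real_cdf_le1 d (T : measurableType d) (R : realType)
    (P : probability T R) (Y : {RV P >-> R}) x : real_cdf Y x <= 1.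
Proof. by rewrite -lee_fin /real_cdf fineK ?fin_num_measure// cdf_le1. Qed.

Section cdf_level.
Context d (T : measurableType d) (R : realType) (P : probability T R).
Context (Y : {RV P >-> R}) (K : nat).

(** [real_cdf Y <= 1], so [inord] never truncates ([cdf_levelE]). *)
Definition cdf_level (x : R) : 'I_K.+1 :=
  inord (Num.truncn (K%:R * real_cdf Y x)).

Lemma cdf_levelE x : cdf_level x = Num.truncn (K%:R * real_cdf Y x) :> nat.
Proof.
rewrite /cdf_level inordK// ltnS truncn_le_nat.
by apply: (@le_lt_trans _ _ K%:R); rewrite ?ltr_nat// ler_piMr// real_cdf_le1.
Qed.

Lemma le_cdf_level x y : x <= y -> (cdf_level x <= cdf_level y)%N.
Proof.
move=> xy; rewrite !cdf_levelE; apply: le_truncn.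
by rewrite ler_wpM2l//; exact: nondecreasing_real_cdf.
Qed.

Lemma measurable_cdf_level (k : 'I_K.+1) : measurable (cdf_level @^-1` [set k]).
Proof.
have Kcdf0 x : 0 <= K%:R * real_cdf Y x by rewrite mulr_ge0// real_cdf_ge0.
have mKcdf : measurable_fun [set: R] (fun x => K%:R * real_cdf Y x).
  apply: nondecreasing_measurable => // x y xy.
  by rewrite ler_wpM2l//; exact: nondecreasing_real_cdf.
rewrite (_ : _ @^-1` _ =
  setT `&` (fun x => K%:R * real_cdf Y x) @^-1` `[k%:R, k.+1%:R[).
  exact: mKcdf.
rewrite setTI; apply/seteqP; split => x /=; rewrite in_itv/=.
  by move=> <-; rewrite -truncn_eq// cdf_levelE.
by rewrite -truncn_eq// => /eqP xk; apply: val_inj; rewrite /= cdf_levelE.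
Qed.

Lemma prob_cdf_level_le x : (0 < K)%N ->
  fine (distribution P Y [set u | (cdf_level u <= cdf_level x)%N]) <=
  real_cdf Y x + K%:R^-1.
Proof.
move=> K0; have K0' : 0 < K%:R :> R by rewrite ltr0n.
rewrite (_ : [set u | _] =
    [set u | real_cdf Y u < (cdf_level x).+1%:R / K%:R]); last first.
  apply/funext => u; apply/propext => /=.
  by rewrite [X in (X <= _)%N]cdf_levelE truncn_le_nat ltr_pdivlMr// mulrC.
apply: (@le_trans _ _ ((cdf_level x).+1%:R / K%:R)).
  have le_s := cdf_prob_lt Y (divr_ge0 (ler0n R (cdf_level x).+1) (ltW K0')).
  by rewrite -lee_fin fineK// ge0_fin_numE// (le_lt_trans le_s)// ltry.
rewrite ler_pdivrMr// mulrDl mulVf ?gt_eqF// -natr1 lerD2r mulrC cdf_levelE.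
by rewrite truncn_le// mulr_ge0// real_cdf_ge0.
Qed.

End cdf_level.

(** The Dvoretzky-Kiefer-Wolfowitz-Massart bound.  The slack [eta] pays
    for the [1 / K] lost by rounding the distribution function to [K] levels. *)
Lemma dkw_one_sided d0 (T0 : measurableType d0) d (T : measurableType d)
    (R : realType) (P0 : probability T0 R) (P : probability T R)
    (Y : {RV P0 >-> R}) (n : nat) (X : 'I_n -> {RV P >-> R}) (eps eta : R) :
  (0 < n)%N -> independent_samples Y X -> 0 < eps -> 0 < eta ->
  holds_with_prob_ge P (1 - expR (- (2 * n%:R * eps ^+ 2)))
    [set omega | forall x,
      empirical_cdf (fun j => X j omega) x <= real_cdf Y x + eps + eta].
Proof.
move=> n0 samples eps0 eta0.
pose K := (Num.truncn eta^-1).+1.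
have Keta : K%:R^-1 <= eta.
  by rewrite -[leRHS]invrK lef_pV2 ?posrE ?invr_gt0// ltW// truncnS_gt.
have [A [mA Asub PA]] := samples_count_le (lev := cdf_level Y K) samples
  (@measurable_cdf_level _ _ _ _ Y K) eps0.
exists A; split => // omega /Asub/= count x.
rewrite /empirical_cdf ler_pdivrMl ?ltr0n//.
have mono : (#|[pred j | (X j omega <= x)%R]| <=
    #|[pred j | (cdf_level Y K (X j omega) <= cdf_level Y K x)%N]|)%N.
  apply: subset_leq_card; apply/fintype.subsetP => j; rewrite !inE.
  exact: le_cdf_level.
apply: le_trans (_ : n%:R * (_ + eps) <= _).
  by apply: le_trans (count (cdf_level Y K x)); rewrite ler_nat.
rewrite ler_wpM2l//; have := prob_cdf_level_le Y x (ltn0Sn _ : (0 < K)%N).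
lra.
Qed.

Lemma independent_samples_linear d0 (T0 : measurableType d0) d
    (T : measurableType d) (R : realType) (P0 : probability T0 R)
    (P : probability T R) (m n : nat) (w : {RV P0 >-> borel_cV R m})
    (X : 'I_n -> {RV P >-> borel_cV R m}) (b : 'rV[R]_m) :
  independent_samples w X ->
  independent_samples (linear_RV b w) (fun j => linear_RV b (X j)).
Proof.
move=> [indep idd].
have mb B : measurable B -> measurable (linear_form b @^-1` B).
  move=> mB; rewrite -[X in measurable X]setTI.
  exact: measurable_linear_form.
split=> [J B mB|j B mB].
  apply: (indep J (fun i => linear_form b @^-1` B i)) => i iJ.
  exact: mb (mB _ iJ).
exact: idd (mb _ mB).
Qed.

Theorem corollary1 (R : realType) (n p N Ns : nat) (Ns_gt0 : (0 < Ns)%N)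
  (* the random vector and its samples *)
  (d0 : measure_display) (Omega0 : measurableType d0)
  (P0 : probability Omega0 R) (w : {RV P0 >-> borel_cV R (p * N)})
  (d : measure_display) (Omega : measurableType d)
  (P : probability Omega R) (ws : 'I_Ns -> {RV P >-> borel_cV R (p * N)})
  (ws_samples : independent_samples w ws)
  (* the data of the problem *)
  (G : 'M[R]_(n * N.+1, p * N)) (p_i : 'cV[R]_(n * N.+1))
  (Sigma : 'M[R]_(p * N)) (Sigma_psd : positive_semidefinite Sigma)
  (x_lb eps epsD epsE alpha : R)
  (eps_gt0 : 0 < eps) (epsD_ge0 : 0 <= epsD) (epsE_gt0 : 0 < epsE)
  (alphaE : alpha = 2 * expR (- (2 * Ns%:R * epsE ^+ 2)))
  (* the pieces of the affine approximation, which depend on the draw *)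
  (z : Omega -> nat) (z_gt0 : forall omega, (1 <= z omega)%N)
  (a c : Omega -> nat -> R) :
  let b : 'rV[R]_(p * N) := p_i^T *m G in
  let y omega j := linear_form b (ws j omega) in
  let Phi := real_cdf (linear_RV b w) in
  let PhiE omega := empirical_cdf (y omega) in
  let Phihat omega := smoothed_cdf (y omega) ((b *m Sigma *m b^T) 0 0) in
  let Phil omega := min_affine (z omega) (a omega) (c omega) in
  holds_with_prob_ge P (1 - alpha)
    [set omega |
      (forall x, x \in `[x_lb, +oo[ ->
        `|PhiE omega x - Phihat omega x| <= epsD) ->
      (forall x, x \in `[x_lb, +oo[ ->
        0 <= Phihat omega x - Phil omega x <= eps) ->
      forall x, x \in `[x_lb, +oo[ ->
        Phil omega x - eps - epsE - epsD <= Phi x].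
Proof.
move=> b y Phi PhiE Phihat Phil.
have [A [mA Asub PA]] := dkw_one_sided Ns_gt0
  (independent_samples_linear b ws_samples) epsE_gt0 eps_gt0.
exists A; split => //.
  move=> omega /Asub/= dkw smoothing affine x xD.
  have := dkw x; rewrite -/(PhiE omega x) -/(Phi x) => dkwx.
  have := smoothing x xD; rewrite ler_norml => /andP[smx _].
  have /andP[affx _] := affine x xD.
  move: dkwx smx affx.
  by move: (PhiE _ _) (Phihat _ _) (Phil _ _) (Phi _) => *; lra.
apply: le_trans PA; rewrite lee_fin alphaE lerD2l lerN2.
by have := expR_ge0 (- (2 * Ns%:R * epsE ^+ 2)); lra.
Qed.
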